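(* For $k\geq 0$ let $R_k(x)=\sum_{n\geq k}\frac{p_{n;\leq n-k}}{n!}x^n$. Then $R_0(x)=P(x)$, $R_1(x)=(1-x)P(x)-1$, and for every $k\geq 1$ $$R_{k+1}(x)=R_k(x)-\sum_{i=1}^{k+1}\frac{x^i}{i!}R_{k+1-i}(x).$$ Furthermore, for every $k\geq 0$, $$R_k(x)=P(x)\sum_{i=0}^{k}\frac{(-1)^i(k+1-i)^i}{i!}x^i-\sum_{i=0}^{k-1}\frac{(-1)^i(k-i)^i}{i!}x^i.$$
   Context: There are $n$ parking spaces in a line numbered $1,\dots,n$; $n$ cars arrive in order, car $j$ has preference $a_j\in[n]$ and parks in the first unoccupied space numbered $\geq a_j$, if any; $(a_1,\dots,a_n)$ is a parking function if all cars park. For $1\le s\le n$, $p_{n;\leq s}$ is the number of parking functions of length $n$ with all $a_j\leq s$; by convention $p_{0;\leq 0}=1$ and $p_{n;\leq 0}=0$ for $n>0$. $P(x)=\sum_{n\geq 0}\frac{(n+1)^{n-1}}{n!}x^n$. *)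

(* Defs.v *)
From HB Require Import structures.
From mathcomp Require Import all_boot all_order all_algebra.
From mathcomp Require Import boolp.

Set Implicit Arguments.
Unset Strict Implicit.
Unset Printing Implicit Defensive.

Import Order.TTheory GRing.Theory Num.Theory.
Local Open Scope ring_scope.

(* Formal power series as a wrapper around coefficient sequences: functions
   carry a pointwise ring structure, whereas the product here is Cauchy's. *)

Record fps (R : Type) := FPS { coefs : nat -> R }.

HB.instance Definition _ (R : Type) := gen_eqMixin (fps R).
HB.instance Definition _ (R : Type) := gen_choiceMixin (fps R).

Lemma fpsP (R : Type) (f g : fps R) : coefs f =1 coefs g -> f = g.
Proof. by case: f g => [f] [g] /= /funext ->. Qed.

Section FpsRing.
Variable R : comNzRingType.
Implicit Types f g h : fps R.

Definition fps_zero : fps R := FPS (fun=> 0).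
Definition fps_opp f : fps R := FPS (fun n => - coefs f n).
Definition fps_add f g : fps R := FPS (fun n => coefs f n + coefs g n).

Lemma fps_addA : associative fps_add.
Proof. by move=> f g h; apply: fpsP => n /=; rewrite addrA. Qed.
Lemma fps_addC : commutative fps_add.
Proof. by move=> f g; apply: fpsP => n /=; rewrite addrC. Qed.
Lemma fps_add0 : left_id fps_zero fps_add.
Proof. by move=> f; apply: fpsP => n /=; rewrite add0r. Qed.
Lemma fps_addN : left_inverse fps_zero fps_opp fps_add.
Proof. by move=> f; apply: fpsP => n /=; rewrite addNr. Qed.

HB.instance Definition _ :=
  GRing.isZmodule.Build (fps R) fps_addA fps_addC fps_add0 fps_addN.

Definition fps_one : fps R := FPS (fun n => (n == 0%N)%:R).
Definition fps_mul f g : fps R :=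
  FPS (fun n => \sum_(i < n.+1) coefs f i * coefs g (n - i)%N).

Let trunc f m : {poly R} := \poly_(i < m) coefs f i.

Let coefs_mul f g m n : (n < m)%N ->
  coefs (fps_mul f g) n = (trunc f m * trunc g m)`_n.
Proof.
move=> lt_nm; rewrite coefM; apply: eq_bigr => i _; rewrite !coef_poly.
by rewrite !ifT // ?(leq_ltn_trans (leq_subr _ _)) // (leq_trans (ltn_ord i)).
Qed.

Lemma fps_mulC : commutative fps_mul.
Proof. by move=> f g; apply: fpsP => n; rewrite !(@coefs_mul _ _ n.+1) // mulrC. Qed.

Lemma fps_mulA : associative fps_mul.
Proof.
move=> f g h; apply: fpsP => n.
have -> : coefs (fps_mul f (fps_mul g h)) n =
          (trunc f n.+1 * (trunc g n.+1 * trunc h n.+1))`_n.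
  rewrite coefM; apply: eq_bigr => i _; rewrite coef_poly ltn_ord.
  by rewrite (@coefs_mul _ _ n.+1) // ltnS leq_subr.
rewrite mulrA coefM; apply: eq_bigr => i _; rewrite (@coefs_mul _ _ n.+1) //.
by rewrite !coef_poly ltnS leq_subr.
Qed.

Lemma fps_mul1 : left_id fps_one fps_mul.
Proof.
move=> f; apply: fpsP => n /=; rewrite big_ord_recl /= mul1r subn0 big1 ?addr0 //.
by move=> i _; rewrite mul0r.
Qed.

Lemma fps_mulD : left_distributive fps_mul fps_add.
Proof.
move=> f g h; apply: fpsP => n /=; rewrite -big_split /=.
by apply: eq_bigr => i _; rewrite mulrDl.
Qed.

Lemma fps_oneNzero : fps_one != 0.
Proof.
by apply/eqP => /(congr1 (fun f => coefs f 0)) /= /eqP; rewrite oner_eq0.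
Qed.

HB.instance Definition _ := GRing.Zmodule_isComNzRing.Build (fps R)
  fps_mulA fps_mulC fps_mul1 fps_mulD fps_oneNzero.

Definition fps_scale (c : R) f : fps R := FPS (fun n => c * coefs f n).

Lemma fps_scaleA a b f : fps_scale a (fps_scale b f) = fps_scale (a * b) f.
Proof. by apply: fpsP => n /=; rewrite mulrA. Qed.
Lemma fps_scale1 : left_id 1 fps_scale.
Proof. by move=> f; apply: fpsP => n /=; rewrite mul1r. Qed.
Lemma fps_scaleDr : right_distributive fps_scale +%R.
Proof. by move=> c f g; apply: fpsP => n /=; rewrite mulrDr. Qed.
Lemma fps_scaleDl f : {morph fps_scale^~ f : a b / a + b}.
Proof. by move=> a b; apply: fpsP => n /=; rewrite mulrDl. Qed.

HB.instance Definition _ := GRing.Zmodule_isLmodule.Build R (fps R)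
  fps_scaleA fps_scale1 fps_scaleDr fps_scaleDl.

Lemma fps_scaleAl (a : R) f g : a *: (f * g) = a *: f * g.
Proof.
apply: fpsP => n /=; rewrite mulr_sumr.
by apply: eq_bigr => i _; rewrite mulrA.
Qed.

HB.instance Definition _ := GRing.Lmodule_isLalgebra.Build R (fps R) fps_scaleAl.

Definition fpsX : fps R := FPS (fun n => (n == 1%N)%:R).

Lemma coefs_fpsXn i n : coefs (fpsX ^+ i) n = (n == i)%:R.
Proof.
elim: i n => [|i IH] n; first by rewrite expr0.
rewrite exprS /=; case: n => [|n]; first by rewrite big_ord1 /= mul0r.
rewrite big_ord_recl /= mul0r add0r big_ord_recl /= mul1r subSS subn0 IH.
by rewrite big1 ?addr0 // => j _; rewrite mul0r.
Qed.

End FpsRing.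

Arguments fpsX {R}.

(* The spaces are the numbers 1, ..., n; [occ] lists the occupied ones. *)
Definition first_free (n : nat) (occ : seq nat) (a : nat) : option nat :=
  ohead [seq i <- iota 1 n | (a <= i)%N && (i \notin occ)].

Fixpoint all_park (n : nat) (occ : seq nat) (prefs : seq nat) : bool :=
  if prefs is a :: prefs' then
    if first_free n occ a is Some i then all_park n (i :: occ) prefs' else false
  else true.

(* The ordinal [i : 'I_n] stands for the preference [i.+1] in {1, ..., n}. *)
Definition prefs (n : nat) (a : n.-tuple 'I_n) : seq nat :=
  [seq (val i).+1 | i <- a].

Definition parking_function (n : nat) (a : n.-tuple 'I_n) : bool :=
  all_park n [::] (prefs a).

Definition park_le (n s : nat) : nat :=
  #|[set a : n.-tuple 'I_n |
      parking_function a && all (fun x => (x <= s)%N) (prefs a)]|.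

(* The general definition already gives the conventional values at s = 0. *)
Lemma park_le00 : park_le 0 0 = 1%N.
Proof.
rewrite /park_le -[RHS](card_tuple 0 'I_0 : _ = (_ ^ 0)%N) -cardsT.
by apply: eq_card => a; rewrite !inE tuple0.
Qed.

Lemma park_leS0 n : park_le n.+1 0 = 0%N.
Proof.
by apply: eq_card0 => a; rewrite !inE; case/tupleP: a => x a /=; rewrite andbF.
Qed.

Definition Pser : fps rat :=
  FPS (fun n => (n.+1%:R : rat) ^ (n%:Z - 1) / n`!%:R).

Definition Rser (k : nat) : fps rat :=
  FPS (fun n => if (k <= n)%N then (park_le n (n - k))%:R / n`!%:R else 0).

(* Main.v *)
Require Import Defs.
From HB Require Import structures.
From mathcomp Require Import all_boot all_order all_algebra.
From mathcomp Require Import zify ring.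

Import Order.TTheory GRing.Theory Num.Theory.
Local Open Scope ring_scope.

(* All cars park iff for every m at most n - m cars prefer a space beyond m.
   Removing the i cars that prefer s therefore gives
   p_(n; <= s) = sum_i C(n, i) p_(n - i; <= s - 1), which is the recursion
   sum_(i <= k + 1) x^i / i! R_(k + 1 - i) = R_k - [k = 0].
   The polynomials A_k = sum_(i < k) (-1)^i (k - i)^i x^i / i! satisfy the same
   recursion up to the sign of [k = 0], by the binomial theorem, whence
   R_k = R_0 A_(k + 1) - A_k. Finally, R_0 = P needs no separate enumeration: the
   coefficient of x^n in R_n, and hence in R_0 A_(n + 1), is p_(n; <= 0) / n! = 0
   for n > 0, which determines R_0; the coefficient of x^n in P A_(n + 1) is an
   n-th finite difference of a polynomial of degree n - 1, so it vanishes too. *)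

(** * Counting criterion for parking *)

Lemma first_freeP (n : nat) (occ : seq nat) (a : nat) :
  match first_free n occ a with
  | Some i => [/\ (a <= i)%N, (0 < i <= n)%N, i \notin occ
              & forall j, (0 < j)%N -> (a <= j < i)%N -> j \in occ]
  | None => forall j, (0 < j <= n)%N -> (a <= j)%N -> j \in occ
  end.
Proof.
rewrite /first_free; set p := fun i => _.
case E: (filter p (iota 1 n)) => [|i s] /=.
  move=> j j1n aj; have := in_nil j; rewrite -E mem_filter mem_iota /p aj /=.
  by case: (j \in occ) => //=; lia.
have : i \in filter p (iota 1 n) by rewrite E mem_head.
rewrite mem_filter mem_iota => /andP[/andP[ai iocc] i1n]; split=> //.
move=> j j0 /andP[aj ji]; apply/negPn/negP => jocc.
have : j \in filter p (iota 1 n).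
  by rewrite mem_filter mem_iota; apply/andP; split; [exact/andP | lia].
have : sorted ltn (filter p (iota 1 n)).
  by apply: sorted_filter; [exact: ltn_trans | exact: iota_ltn_sorted].
rewrite E /= => /(order_path_min ltn_trans) /allP lt_is.
by rewrite inE => /orP[/eqP|/lt_is /=]; lia.
Qed.

Lemma count_gt_uniq (n m : nat) (occ : seq nat) :
  uniq occ -> all (fun x => x <= n)%N occ -> (count (fun x => m < x) occ <= n - m)%N.
Proof.
move=> uocc /allP occ_le; rewrite -size_filter -(size_iota m.+1 (n - m)).
apply: uniq_leq_size; first exact: filter_uniq.
by move=> x; rewrite mem_filter mem_iota => /andP[mx /occ_le]; lia.
Qed.

(** The spaces of the full block lie beyond [a] but not beyond [b], so they separate the two
    counts. *)
Lemma count_gt_interval (a b : nat) (occ : seq nat) : (a <= b)%N ->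
  (forall j, (a < j <= b)%N -> j \in occ) ->
  (b - a + count (fun x => b < x) occ <= count (fun x => a < x) occ)%N.
Proof.
move=> ab full.
rewrite -[X in (X + _)%N](size_iota a.+1) -!size_filter -size_cat.
have -> : size [seq x <- occ | (a < x)%N] =
    (size [seq x <- occ | (a < x <= b)%N] + size [seq x <- occ | (b < x)%N])%N.
  by rewrite !size_filter; elim: (occ) => //= x s ->; lia.
rewrite size_cat leq_add2r; apply: uniq_leq_size; first exact: iota_uniq.
by move=> j; rewrite mem_iota mem_filter => jab; rewrite full; lia.
Qed.

(* If the first car prefers [a] and parks at [i], then the spaces from [a] to
   [i - 1] are occupied, so the inequality at [a - 1] implies the new one at every
   [m] with [a <= m < i]; the other inequalities do not get stronger. *)
Lemma all_parkP (n : nat) (occ cars : seq nat) :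
  uniq occ -> all (fun x => x <= n)%N occ -> all (leq 1) cars ->
  reflect (forall m, (m <= n)%N ->
             (count (fun x => m < x) occ + count (fun x => m < x) cars <= n - m)%N)
          (all_park n occ cars).
Proof.
elim: cars occ => [|a cars IH] occ uocc occ_le /=.
  by move=> _; left=> m _; rewrite addn0 count_gt_uniq.
case/andP=> a_gt0 cars_gt0; have := first_freeP n occ a.
case: (first_free n occ a) => [i [ai i1n iocc full]|full]; last first.
  (* The first car fails to park, so the inequality breaks at [m = min(a - 1, n)]: all spaces beyond
     [m] are full and the car itself adds one. The minimum covers [a > n]. *)
  have {}full j : (minn a.-1 n < j <= n)%N -> j \in occ by move=> jn; apply: full; lia.
  right=> /(_ (minn a.-1 n) (geq_minr _ _)).
  have := @count_gt_interval _ _ occ (geq_minr a.-1 n) full.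
  by lia.
apply: (iffP (IH (i :: occ) _ _ _)) => //=.
- by rewrite iocc.
- by rewrite occ_le andbT; lia.
- by move=> H m mn; have := H m mn; lia.
move=> H m mn; case: (ltnP m a) => [ma|am]; first by have := H m mn; lia.
case: (ltnP m i) => [mi|im]; last by have := H m mn; lia.
have full' j : (a.-1 < j <= m)%N -> j \in occ by move=> ja; apply: full; lia.
have le_am : (a.-1 <= m)%N by lia.
have := H a.-1 (leq_trans le_am mn); have := @count_gt_interval _ _ occ le_am full'.
have : (count (fun x => m < x) cars <= count (fun x => a.-1 < x) cars)%N.
  by apply: sub_count => x /=; lia.
by lia.
Qed.

Lemma parking_functionP (n : nat) (a : n.-tuple 'I_n) :
  reflect (forall m, (m <= n)%N -> (count (fun x => m < x) (prefs a) <= n - m)%N)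
          (parking_function a).
Proof.
apply: (@all_parkP n [::]) => //.
by apply/allP => _ /mapP[x _ ->].
Qed.

(** * Counting maps by the preimage of the top value *)

(* Value at [(n, s)]: maps from an [n]-set to {1, ..., s} with at least [m]
   arguments sent to {1, ..., m} for every [m <= s]; the recursion sums over the
   number [i] of arguments sent to [s]. *)
Fixpoint prefix_maps_count (n s : nat) : nat :=
  if s is s'.+1 then
    if (s' < n)%N then (\sum_(i < n.+1) 'C(n, i) * prefix_maps_count (n - i) s')%N
    else 0%N
  else (n == 0%N).

Lemma prefix_maps_count_small n s : (n < s)%N -> prefix_maps_count n s = 0%N.
Proof. by case: s => // s; rewrite ltnS /= ltnNge => ->. Qed.

Section PrefixMaps.
Variables (T : finType) (N : nat).
Implicit Types (D S : {set T}) (f g : {ffun T -> 'I_N.+1}).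

(* The value 0 marks the arguments outside of [D]. *)
Definition prefix_maps D (s : nat) : {set {ffun T -> 'I_N.+1}} :=
  [set f : {ffun T -> 'I_N.+1} |
    [&& [forall x, (x \in D) == (0 < f x)%N], [forall x, (f x <= s)%N]
      & [forall m : 'I_N.+1, (m <= s)%N ==> (m <= #|[set x in D | (f x <= m)%N]|)%N]]].

Lemma prefix_mapsP D s f : (s <= N)%N ->
  reflect [/\ forall x, (x \in D) = (0 < f x)%N, forall x, (f x <= s)%N
            & forall m, (m <= s)%N -> (m <= #|[set x in D | (f x <= m)%N]|)%N]
          (f \in prefix_maps D s).
Proof.
move=> sN; rewrite inE; apply: (iffP and3P) => -[].
  move=> /forallP fD /forallP fs /forallP fm; split=> [x|//|m ms].
    exact/eqP/fD.
  have mN : (m < N.+1)%N by lia.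
  by have /implyP/(_ ms) := fm (Ordinal mN).
move=> fD fs fm; split; apply/forallP => x //; first exact/eqP.
by apply/implyP => /fm.
Qed.

Definition extend_top S (s : nat) g : {ffun T -> 'I_N.+1} :=
  [ffun x => if x \in S then inord s else g x].

(** On [S] both maps take the marker 0, since [S] misses [D :\: S]. *)
Lemma extend_top_inj D S s : (s <= N)%N ->
  {in prefix_maps (D :\: S) s &, injective (extend_top S s.+1)}.
Proof.
move=> sN g h /(prefix_mapsP _ _ _ sN)[gD _ _] /(prefix_mapsP _ _ _ sN)[hD _ _].
move=> /ffunP gh; apply/ffunP => x; have := gh x; rewrite !ffunE.
case: ifP => // xS _; apply: val_inj => /=.
have := gD x; have := hD x; rewrite inE xS /=; lia.
Qed.

(** Arguments sent to [s.+1] count only in the inequality at [m = s.+1], which amounts to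
    [s < #|D|]; the other inequalities are those of the restriction to [D :\: S]. *)
Lemma prefix_maps_fibre D S s : (s < N)%N -> (s < #|D|)%N -> S \subset D ->
  [set f in prefix_maps D s.+1 | [set x | val (f x) == s.+1] == S] =
  extend_top S s.+1 @: prefix_maps (D :\: S) s.
Proof.
move=> sN sD SD; have sN' := ltnW sN; apply/setP => f; rewrite inE; apply/andP/imsetP.
  case=> /(prefix_mapsP _ _ _ sN)[fD fs fm] /eqP/setP fS.
  have {}fS x : (x \in S) = (val (f x) == s.+1) by rewrite -fS inE.
  (* Resetting the top fibre to the marker 0 inverts [extend_top]. *)
  exists [ffun x => if x \in S then ord0 else f x].
    apply/(prefix_mapsP _ _ _ sN'); split=> [x|x|m ms].
    - by rewrite ffunE inE fD; case: ifP.
    - by rewrite ffunE fS; case: ifP => //; have := fs x; case: eqP => //= /eqP; lia.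
    have ms1 : (m <= s.+1)%N by lia.
    apply: leq_trans (fm m ms1) _; apply: subset_leq_card; apply/subsetP => x.
    rewrite !inE ffunE => /andP[-> fxm]; have := fS x => /=.
    by case: (x \in S) => /esym /=; [lia | rewrite fxm].
  apply/ffunP => x; rewrite !ffunE; case: ifP => xS; last by rewrite xS.
  have fx : val (f x) = s.+1 by apply/eqP; rewrite -fS.
  by apply: val_inj; rewrite /= inordK ?ltnS.
case=> g /(prefix_mapsP _ _ _ sN')[gD gs gm] ->.
have vE x : val (extend_top S s.+1 g x) = if x \in S then s.+1 else val (g x).
  by rewrite ffunE; case: ifP => //= _; rewrite inordK ?ltnS.
split.
  apply/(prefix_mapsP _ _ _ sN); split=> [x|x|m].
  - rewrite [nat_of_ord _]vE; have := gD x; rewrite inE; have := subsetP SD x.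
    by case: (x \in S) => //= ->.
  - by rewrite [nat_of_ord _]vE; case: ifP => // _; exact: leqW (gs x).
  rewrite leq_eqVlt => /predU1P[->|].
    rewrite (_ : [set _ in _ | _] = D) //; apply/setP => x.
    rewrite inE [nat_of_ord _]vE; case: (x \in D) => //=.
    by case: ifP => _; rewrite ?leqnn // (leqW (gs x)).
  rewrite ltnS => ms; apply: leq_trans (gm m ms) _.
  apply: subset_leq_card; apply/subsetP => x.
  rewrite !inE -andbA => /and3P[/negPf xS -> gxm].
  by rewrite [nat_of_ord _]vE xS.
apply/eqP/setP => x; rewrite inE vE; case: ifP => _; first by rewrite eqxx.
by have := gs x => /=; lia.
Qed.

Lemma card_prefix_maps D s : (s <= N)%N ->
  #|prefix_maps D s| = prefix_maps_count #|D| s.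
Proof.
elim: s D => [|s IH] D sN /=.
  case: (eqVneq #|D| 0%N) => [/cards0_eq ->|D0].
    apply/eqP/cards1P; exists [ffun=> ord0]; apply/setP => f; rewrite !inE.
    apply/idP/eqP => [/and3P[_ /forallP f0 _]|->].
      by apply/ffunP => x; apply: val_inj; rewrite ffunE /=; have := f0 x; lia.
    apply/and3P; split; apply/forallP => x; rewrite ?inE ?ffunE //.
    by apply/implyP; rewrite leqn0 => /eqP->.
  apply/eqP; rewrite cards_eq0; apply/eqP/setP => f; rewrite in_set0.
  apply/negP => /(prefix_mapsP _ _ _ sN)[fD f0 _]; case/negP: D0.
  by rewrite cards_eq0; apply/eqP/setP => x; rewrite fD inE; have := f0 x; lia.
case: ltnP => sD; last first.
  apply/eqP; rewrite cards_eq0; apply/eqP/setP => f; rewrite in_set0.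
  apply/negP => /(prefix_mapsP _ _ _ sN)[_ _ /(_ _ (leqnn _))] lt_s.
  have /subset_leq_card : [set x in D | (f x <= s.+1)%N] \subset D.
    by apply/subsetP => x; rewrite inE => /andP[].
  by move/(leq_trans lt_s); rewrite ltnNge sD.
(* Split by the preimage [S] of [s.+1], then by its size. *)
rewrite -[LHS]sum1_card (partition_big (fun f : {ffun T -> 'I_N.+1} =>
  [set x | val (f x) == s.+1]) (fun S => S \subset D)) /=; last first.
  move=> f /(prefix_mapsP _ _ _ sN)[fD _ _]; apply/subsetP => x.
  by rewrite inE fD => /eqP /= ->.
transitivity (\sum_(S : {set T} | S \subset D) prefix_maps_count (#|D| - #|S|) s)%N.
  apply: eq_bigr => S SD; rewrite sum1dep_card.
  have -> : [set f | (f \in prefix_maps D s.+1) && ([set x | val (f x) == s.+1] == S)]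
    = extend_top S s.+1 @: prefix_maps (D :\: S) s by exact: prefix_maps_fibre.
  rewrite card_in_imset; last by apply: extend_top_inj; exact: ltnW.
  by rewrite IH ?(ltnW sN) // cardsD (setIidPr SD).
rewrite (partition_big (fun S : {set T} => inord #|S| : 'I_#|D|.+1) xpredT) //=.
apply: eq_bigr => i _; rewrite -cards_draws -sum_nat_cond_const.
apply: eq_big => [S|S /andP[SD /eqP <-]].
  case SD: (S \subset D) => //=; rewrite -val_eqE /= inordK //.
  by rewrite ltnS subset_leq_card.
by rewrite inordK // ltnS subset_leq_card.
Qed.

End PrefixMaps.

(** Preferences are read as a map on all of ['I_n]: at most [n - m] cars beyond [m] means at least
    [m] cars up to [m]. *)
Lemma park_leE n s : (s <= n)%N -> park_le n s = prefix_maps_count n s.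
Proof.
move=> sn; rewrite -{2}(card_ord n) -cardsT -(@card_prefix_maps _ n) //.
pose F (a : n.-tuple 'I_n) : {ffun 'I_n -> 'I_n.+1} :=
  [ffun x => lift ord0 (tnth a x)].
have FE a x : F a x = (tnth a x).+1 :> nat by rewrite ffunE.
have F_inj : injective F.
  move=> a b /ffunP ab; apply: eq_from_tnth => x; apply: val_inj.
  by have := congr1 val (ab x); rewrite /= !FE => -[].
rewrite /park_le -(card_imset _ F_inj); apply: eq_card => f.
have countE a (p : pred nat) : count p (prefs a) = #|[set x | p (F a x)]|.
  rewrite count_map -sum1_count big_tuple sum1dep_card.
  by apply: eq_card => x; rewrite !inE FE.
have leE a m : (m <= n)%N -> (count (fun x => m < x) (prefs a) <= n - m)%N =
    (m <= #|[set x in setT | (F a x <= m)%N]|)%N.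
  move=> mn; rewrite countE.
  have -> : [set x in setT | (F a x <= m)%N] = ~: [set x | (m < F a x)%N].
    by apply/setP => x; rewrite !inE -leqNgt.
  by have := cardsC [set x | (m < F a x)%N]; rewrite card_ord; lia.
apply/imsetP/(prefix_mapsP _ _ _ _ _ sn) => [[a]|[fD fs fm]].
  rewrite inE => /andP[/parking_functionP park /allP a_le] ->.
  split=> [x|x|m ms].
  - by rewrite inE FE.
  - by rewrite FE; apply: a_le; apply: map_f; apply: mem_tnth.
  by rewrite -leE ?park // (leq_trans ms).
have f_gt0 x : ord0 != f x by rewrite -val_eqE /= eq_sym -lt0n -fD inE.
(* The default of [odflt] is never reached, as [f x] is nonzero. *)
pose a := [tuple odflt (Ordinal (leq_ltn_trans (leq0n _) (ltn_ord x)))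
                    (unlift ord0 (f x)) | x < n].
have fa : f = F a.
  apply/ffunP => x; rewrite ffunE tnth_mktuple.
  by have [j fxj ->] := unlift_some (f_gt0 x).
exists a => //; rewrite inE; apply/andP; split; last first.
  apply/allP => _ /mapP[_ /tnthP[x ->] ->]; have := fs x.
  by rewrite fa FE.
apply/parking_functionP => m mn; rewrite leE //.
case: (leqP m s) => [ms|sm]; first by rewrite -fa fm.
(* Beyond [s] the condition is automatic, all values being at most [s]. *)
have -> : [set x in setT | (F a x <= m)%N] = setT.
  by apply/setP => x; rewrite !inE -fa (leq_trans (fs x) (ltnW sm)).
by rewrite cardsT card_ord.
Qed.

(** * Coefficients and exponential convolution *)

Lemma coefsD (R : comNzRingType) (f g : fps R) n :
  coefs (f + g) n = coefs f n + coefs g n.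
Proof. by []. Qed.

Lemma coefsN (R : comNzRingType) (f : fps R) n : coefs (- f) n = - coefs f n.
Proof. by []. Qed.

Lemma coefs_sum (R : comNzRingType) I (r : seq I) (P : pred I) (F : I -> fps R) n :
  coefs (\sum_(i <- r | P i) F i) n = \sum_(i <- r | P i) coefs (F i) n.
Proof. exact: (big_morph (fun f => coefs f n)). Qed.

Lemma coefsM (R : comNzRingType) (f g : fps R) n :
  coefs (f * g) n = \sum_(i < n.+1) coefs f i * coefs g (n - i).
Proof. by []. Qed.

Lemma coefsZXn (R : comNzRingType) (c : R) i n :
  coefs (c *: fpsX ^+ i) n = if n == i then c else 0.
Proof.
rewrite -[LHS]/(c * coefs (fpsX ^+ i) n) coefs_fpsXn.
by case: eqP; rewrite ?mulr1 ?mulr0.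
Qed.

Lemma coefsZXnM (R : comNzRingType) (c : R) i (f : fps R) n :
  coefs ((c *: fpsX ^+ i) * f) n = if (i <= n)%N then c * coefs f (n - i) else 0.
Proof.
rewrite coefsM; under eq_bigr do rewrite coefsZXn.
case: leqP => [le_in|lt_ni].
  rewrite (bigD1 (inord i)) //= inordK // eqxx big1 ?addr0 // => j /eqP ij.
  by case: eqP => [ji|]; rewrite ?mul0r //; case: ij; apply: val_inj; rewrite /= inordK.
by apply: big1 => j _; case: eqP => [ji|]; rewrite ?mul0r //; have := ltn_ord j; lia.
Qed.

Lemma coefs_nat (R : comNzRingType) (b : bool) n :
  coefs (b%:R : fps R) n = (b && (n == 0%N))%:R.
Proof. by case: b. Qed.

(** This is the coefficient of [y^k] in [e^(x y) * sum_j F_j y^j]. *)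
Definition exp_conv (F : nat -> fps rat) (k : nat) : fps rat :=
  \sum_(0 <= i < k.+1) ((i`!%:R : rat)^-1 *: fpsX ^+ i) * F (k - i)%N.

Lemma exp_conv_recl F k : exp_conv F k =
  F k + \sum_(1 <= i < k.+1) ((i`!%:R : rat)^-1 *: fpsX ^+ i) * F (k - i)%N.
Proof.
by rewrite /exp_conv big_nat_recl // big_add1 subn0 invr1 scale1r expr0 mul1r.
Qed.

Lemma coefs_exp_conv F k n : coefs (exp_conv F k) n =
  \sum_(i < k.+1 | (i <= n)%N) (i`!%:R)^-1 * coefs (F (k - i)%N) (n - i).
Proof.
rewrite /exp_conv coefs_sum big_mkord [RHS]big_mkcond.
by apply: eq_bigr => i _; rewrite coefsZXnM.
Qed.

(* The recursion determines [F k.+1] since the summand [i = 0] of [exp_conv] is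
   [F k.+1] itself. *)
Lemma exp_conv_uniq F G : F 0%N = G 0%N ->
  (forall k, exp_conv F k.+1 - F k = exp_conv G k.+1 - G k) -> F =1 G.
Proof.
move=> FG0 FG; elim/ltn_ind=> -[//|k] IH.
have := FG k; rewrite !exp_conv_recl (IH k) // => /addIr.
rewrite (eq_big_nat _ _ (F2 := fun i => (i`!%:R^-1 *: fpsX ^+ i) * G (k.+1 - i)%N)).
  by move/addIr.
by move=> i ik; rewrite IH //; lia.
Qed.

Lemma exp_conv_lin (f : fps rat) F G k :
  exp_conv (fun j => f * F j.+1 - G j) k =
  f * exp_conv (F \o S) k - exp_conv G k.
Proof.
rewrite /exp_conv mulr_sumr -sumrB; apply: eq_bigr => i _.
by rewrite mulrBr mulrCA.
Qed.

Lemma bin_factV n i : (i <= n)%N ->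
  (i`!%:R)^-1 * ((n - i)`!%:R)^-1 = 'C(n, i)%:R / n`!%:R :> rat.
Proof.
move=> le_in; rewrite -(bin_fact le_in) !natrM -invfM.
have b0 : 'C(n, i)%:R != 0 :> rat by rewrite pnatr_eq0 -lt0n bin_gt0.
by rewrite [in RHS]invfM mulVKf.
Qed.

(** * Recursions for [Rser] and [Aser] *)

Lemma coefs_Rser k n :
  coefs (Rser k) n =
  if (k <= n)%N then (prefix_maps_count n (n - k))%:R / n`!%:R else 0.
Proof. by rewrite /=; case: ifP => // kn; rewrite park_leE ?leq_subr. Qed.

(** Divided by [n!], the recursion of [prefix_maps_count] is an exponential convolution; on the
    diagonal [s = n - k] it links the indices up to [k.+1] with [k]. *)
Lemma exp_conv_Rser k : exp_conv Rser k.+1 = Rser k - (k == 0%N)%:R.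
Proof.
apply: fpsP => n; rewrite coefs_exp_conv coefsD coefsN coefs_nat coefs_Rser.
case: (leqP k.+1 n) => [lt_kn|le_nk].
  rewrite (ltnW lt_kn).
  have -> : (k == 0%N) && (n == 0%N) = false by lia.
  rewrite subr0 -(subnSK lt_kn) /= ifT; last by lia.
  rewrite natr_sum mulr_suml.
  (* The terms with [i > k.+1] on the other side vanish because [n - i < n - k.+1]. *)
  rewrite (big_ord_widen_cond n.+1 (fun i => (i <= n)%N) (fun i =>
    (i`!%:R)^-1 * coefs (Rser (k.+1 - i)%N) (n - i))) //.
  rewrite big_mkcond; apply: eq_bigr => i _; case: ifP => [/andP[le_in le_ik]|].
    rewrite coefs_Rser ifT; last by lia.
    have -> : (n - i - (k.+1 - i) = n - k.+1)%N by lia.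
    by rewrite natrM mulrCA bin_factV // mulrCA mulrA.
  move=> le_ik; rewrite prefix_maps_count_small ?muln0 ?mul0r //.
  by have := ltn_ord i; lia.
(* All terms on the left vanish; at [n = k] the right side is [p_(k; <= 0) / k!] minus its value
   [[k = 0]]. *)
rewrite big1 => [|i le_in]; last by rewrite coefs_Rser ifF ?mulr0 //; lia.
case: leqP => [le_kn|lt_nk]; last first.
  by have -> : (k == 0%N) && (n == 0%N) = false by lia; rewrite subr0.
have -> : n = k by lia.
by rewrite subnn andbb; case: k {le_nk le_kn} => [|k];
  rewrite /= ?mul0r ?subr0 ?fact0 ?divr1 ?subrr.
Qed.

(** The generating function [sum_k A_k y^k] is [y / (e^(x y) - y)]. *)
Definition Aser (k : nat) : fps rat :=
  \sum_(0 <= i < k) ((-1) ^+ i * (k - i)%N%:R ^+ i / i`!%:R : rat) *: fpsX ^+ i.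

Lemma coefs_Aser k n : coefs (Aser k) n =
  if (n < k)%N then (-1) ^+ n * (k - n)%N%:R ^+ n / n`!%:R else 0.
Proof.
rewrite /Aser coefs_sum big_mkord; under eq_bigr do rewrite coefsZXn.
case: ltnP => [lt_nk|le_kn].
  rewrite (bigD1 (Ordinal lt_nk)) //= eqxx big1 ?addr0 // => i.
  by rewrite -val_eqE eq_sym /= => /negPf->.
by apply: big1 => i _; rewrite gtn_eqF // (leq_trans _ le_kn).
Qed.

Lemma Aser0 : Aser 0 = 0. Proof. by rewrite /Aser big_geq. Qed.

Lemma Aser1 : Aser 1 = 1.
Proof. by rewrite /Aser big_nat1 !expr0 invr1 !mulr1 scale1r. Qed.

Lemma exp_conv_Aser k : exp_conv Aser k.+1 = Aser k + (k == 0%N)%:R.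
Proof.
apply: fpsP => n; rewrite coefs_exp_conv coefsD coefs_nat coefs_Aser.
case: (leqP n k) => [le_nk|lt_kn]; last first.
  rewrite big1 => [|i le_in]; last by rewrite coefs_Aser ifF ?mulr0 //; lia.
  have -> : (k == 0%N) && (n == 0%N) = false by lia.
  by rewrite ifF ?addr0 //; lia.
(* The convolution is the binomial expansion of [(1 - (k + 1 - n))^n]. *)
transitivity ((- (k - n)%N%:R) ^+ n / n`!%:R : rat).
  have -> : - (k - n)%N%:R = - (k.+1 - n)%N%:R + 1 :> rat.
    by rewrite subSn // -natr1 opprD addrNK.
  rewrite exprDn mulr_suml.
  rewrite [RHS](big_ord_widen _ (fun i => (- (k.+1 - n)%N%:R) ^+ (n - i) * 1 ^+ i
    *+ 'C(n, i) / n`!%:R : rat) (_ : n.+1 <= k.+2)%N); last by lia.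
  apply: eq_bigr => i le_in; rewrite coefs_Aser ifT; last by lia.
  have -> : (k.+1 - i - (n - i) = k.+1 - n)%N by lia.
  rewrite expr1n mulr1 [in RHS]exprNn -(mulr_natr (_ * _)) [LHS]mulrCA bin_factV //.
  by rewrite mulrA.
rewrite exprNn; case: ltnP => [lt_nk|le_kn].
  have -> : (k == 0%N) && (n == 0%N) = false by lia.
  by rewrite addr0.
(* Here [0^n] leaves exactly the correction [[k = 0]]. *)
have -> : n = k by lia.
by rewrite subnn andbb; case: (k) => [|j];
  rewrite ?expr0 ?expr0n /= ?mulr0 ?mul0r ?addr0.
Qed.

(** Both sides start from [Rser 0] and obey the same recursion. *)
Lemma Rser_Aser k : Rser k = Rser 0 * Aser k.+1 - Aser k.
Proof.
apply: (exp_conv_uniq Rser (fun k => Rser 0 * Aser k.+1 - Aser k)) => [|{}k].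
  by rewrite Aser1 Aser0 mulr1 subr0.
rewrite exp_conv_lin exp_conv_Rser exp_conv_Aser.
(* Since [Aser 0 = 0], one more term turns the shifted convolution at [k.+1] into the plain one at
   [k.+2]. *)
have -> : exp_conv (Aser \o S) k.+1 = Aser k.+1.
  transitivity (exp_conv Aser k.+2); last by rewrite exp_conv_Aser addr0.
  rewrite /exp_conv [RHS]big_nat_recr //= subnn Aser0 mulr0 addr0.
  by apply: eq_big_nat => i ik; rewrite -subSn //; lia.
by ring.
Qed.

(** * Identification of [Rser 0] with [Pser] *)

(* An [n]-th finite difference kills polynomials of degree [m < n]. *)
Lemma alternating_bin_powers (x : rat) m n : (m < n)%N ->
  \sum_(j < n.+1) (-1) ^+ j * 'C(n, j)%:R * (x + j%:R) ^+ m = 0.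
Proof.
elim: m n x => [|m IH] n x lt_mn.
  have := exprDn (1 : rat) (-1) n; rewrite subrr expr0n gtn_eqF // => /esym H.
  rewrite -[RHS]H; apply: eq_bigr => j _.
  by rewrite expr0 mulr1 expr1n mul1r mulr_natr.
(* Split off one factor [x + j] and use [j C(n, j) = n C(n - 1, j - 1)], with [j] shifted by one in
   the second sum. *)
transitivity (x * (\sum_(j < n.+1) (-1) ^+ j * 'C(n, j)%:R * (x + j%:R) ^+ m)
  - n%:R * (\sum_(j < n) (-1) ^+ j * 'C(n.-1, j)%:R * (x + 1 + j%:R) ^+ m) : rat).
  rewrite !mulr_sumr big_ord_recl [in RHS]big_ord_recl /= -addrA -sumrB.
  congr (_ + _); first by rewrite exprS addr0; ring.
  apply: eq_bigr => j _; rewrite /bump /= !add1n.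
  have -> : n%:R * ((-1) ^+ j * 'C(n.-1, j)%:R * (x + 1 + j%:R) ^+ m) =
     (-1) ^+ j * (j.+1%:R * 'C(n, j.+1)%:R) * (x + 1 + j%:R) ^+ m :> rat.
    by rewrite -natrM -mul_bin_diag natrM; ring.
  have -> : x + 1 + j%:R = x + j.+1%:R by rewrite -addrA [1 + _]addrC natr1.
  by rewrite exprS [in LHS](exprS (x + _)); ring.
rewrite IH 1?ltnW //; case: n lt_mn => // n lt_mn.
by rewrite IH // !mulr0 subr0.
Qed.

Lemma coefs_Pser_Aser n : (0 < n)%N -> coefs (Pser * Aser n.+1) n = 0.
Proof.
case: n => // n _; rewrite coefsM.
transitivity ((-1) ^+ n.+1 / (n.+1)`!%:R *
  \sum_(j < n.+2) (-1) ^+ j * 'C(n.+1, j)%:R * (1 + j%:R) ^+ n : rat); last first.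
  by rewrite alternating_bin_powers ?mulr0.
rewrite mulr_sumr; apply: eq_bigr => j _; have le_jn : (j <= n.+1)%N by rewrite -ltnS.
rewrite coefs_Aser ifT; last by lia.
have -> : (n.+2 - (n.+1 - j) = j.+1)%N by lia.
have jE : 1 + j%:R = j.+1%:R :> rat by rewrite addrC natr1.
have j0 : j.+1%:R != 0 :> rat by rewrite pnatr_eq0.
(* The exponents [j - 1] and [n + 1 - j] add up to [n]; at [j = 0] the first is [-1], hence integer
   powers and [j0]. *)
have powE : (j.+1%:R : rat) ^ (j%:Z - 1) * j.+1%:R ^+ (n.+1 - j) = j.+1%:R ^+ n.
  rewrite [RHS]exprnP (exprnP _ (n.+1 - j)) -expfzDr //; congr (_ ^ _).
  by rewrite -subzn //; lia.
have sgE : (-1) ^+ (n.+1 - j) = (-1) ^+ n.+1 * (-1) ^+ j :> rat.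
  by rewrite -signr_odd oddB // signr_addb !signr_odd.
rewrite jE -powE sgE /=.
set p := _ ^ _; set q := _ ^+ (n.+1 - j).
transitivity ((-1) ^+ n.+1 * (-1) ^+ j * p * q *
  ((j`!%:R)^-1 * ((n.+1 - j)`!%:R)^-1) : rat); first by ring.
by rewrite bin_factV //; ring.
Qed.

Lemma Aser_coef0 k : coefs (Aser k.+1) 0 = 1.
Proof. by rewrite coefs_Aser /= !expr0 invr1 !mulr1. Qed.

(* The coefficient of degree [n] vanishes in [Rser n], hence in
   [Rser 0 * Aser n.+1], which determines [Rser 0] one coefficient at a time. *)
Lemma Rser0 : Rser 0 = Pser.
Proof.
apply: fpsP; elim/ltn_ind=> -[_|n IH].
  by rewrite coefs_Rser /= exp1rz.
have R0 : coefs (Rser 0 * Aser n.+2) n.+1 = 0.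
  have := congr1 (fun f => coefs f n.+1) (Rser_Aser n.+1).
  rewrite coefsD coefsN [coefs (Aser n.+1) _]coefs_Aser ltnn subr0 => <-.
  by rewrite coefs_Rser leqnn subnn /= mul0r.
(* The constant term 1 of [Aser n.+2] isolates the top coefficient of [f]. *)
have splitE f : coefs (f * Aser n.+2) n.+1 =
    \sum_(i < n.+1) coefs f i * coefs (Aser n.+2) (n.+1 - i) + coefs f n.+1.
  rewrite coefsM big_ord_recr; congr (_ + _).
  by rewrite -[nat_of_ord ord_max]/n.+1 subnn Aser_coef0 mulr1.
have := coefs_Pser_Aser n.+1 isT; rewrite -R0 !splitE.
under eq_bigr do rewrite -IH //.
by move/addrI => /esym.
Qed.

Theorem theorem3p2 :
  [/\ Rser 0 = Pser,
      Rser 1 = (1 - fpsX) * Pser - 1,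
      forall k : nat, (1 <= k)%N ->
        Rser k.+1 = Rser k -
          \sum_(1 <= i < k.+2) ((i`!%:R : rat)^-1 *: fpsX ^+ i) * Rser (k.+1 - i)%N
    & forall k : nat,
        Rser k =
          Pser * (\sum_(0 <= i < k.+1)
                    ((-1) ^+ i * (k.+1 - i)%N%:R ^+ i / i`!%:R : rat) *: fpsX ^+ i)
          - \sum_(0 <= i < k)
              ((-1) ^+ i * (k - i)%N%:R ^+ i / i`!%:R : rat) *: fpsX ^+ i].
Proof.
split=> [||[//|k] _|k].
- exact: Rser0.
(* The correction [[k = 0]] becomes the final [- 1]. *)
- have := exp_conv_Rser 0; rewrite exp_conv_recl big_nat1 subnn Rser0 eqxx.
  by rewrite invr1 scale1r expr1 => /(canRL (addrK _)) ->; rewrite mulrBl mul1r addrAC.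
- by have := exp_conv_Rser k.+1; rewrite subr0 exp_conv_recl => /(canRL (addrK _)).
by rewrite -Rser0; exact: Rser_Aser.
Qed.
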